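(* Let $G^{\phi}$ be a $3$-regular optimum Hermitian energy mixed graph whose underlying graph $G$ is the hypercube $Q_3$. Then, up to isomorphism of mixed graphs and switching equivalence, $G^{\phi}$ is one of the seven mixed graphs $D_2,H_1,H_2,H_3,H_4,H_5,H_6$; that is, $G^\phi$ is isomorphic to a mixed graph that is switching equivalent to one of them. Here all seven have vertex set $\{v_1,\dots,v_8\}$ and underlying graph the cube with the $12$ edges $v_1v_2,v_3v_4,v_5v_6,v_7v_8,v_1v_3,v_2v_4,v_5v_7,v_6v_8,v_1v_5,v_2v_6,v_3v_7,v_4v_8$, and they are the following: $D_2$ (oriented graph): arcs $v_1\to v_2,\ v_4\to v_3,\ v_1\to v_3,\ v_2\to v_4,\ v_6\to v_5,\ v_7\to v_8,\ v_7\to v_5,\ v_8\to v_6,\ v_1\to v_5,\ v_2\to v_6,\ v_3\to v_7,\ v_4\to v_8$. $H_1$: undirected edges $v_1\leftrightarrow v_2,\ v_1\leftrightarrow v_3,\ v_1\leftrightarrow v_5$; arcs $v_3\to v_4,\ v_4\to v_2,\ v_2\to v_6,\ v_6\to v_5,\ v_5\to v_7,\ v_7\to v_3,\ v_4\to v_8,\ v_6\to v_8,\ v_7\to v_8$. $H_2$: undirected edges $v_1\leftrightarrow v_3,\ v_2\leftrightarrow v_4,\ v_5\leftrightarrow v_7,\ v_6\leftrightarrow v_8$; arcs $v_1\to v_2,\ v_2\to v_6,\ v_6\to v_5,\ v_1\to v_5,\ v_4\to v_3,\ v_8\to v_4,\ v_7\to v_8,\ v_7\to v_3$. $H_3$: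 undirected edges $v_1\leftrightarrow v_3,\ v_1\leftrightarrow v_2,\ v_5\leftrightarrow v_7,\ v_5\leftrightarrow v_6$; arcs $v_3\to v_4,\ v_4\to v_2,\ v_7\to v_8,\ v_8\to v_6,\ v_4\to v_8,\ v_6\to v_2,\ v_1\to v_5,\ v_7\to v_3$. $H_4$: undirected edges $v_1\leftrightarrow v_3,\ v_1\leftrightarrow v_2,\ v_3\leftrightarrow v_7,\ v_5\leftrightarrow v_6,\ v_7\leftrightarrow v_8$; arcs $v_3\to v_4,\ v_4\to v_2,\ v_4\to v_8,\ v_7\to v_5,\ v_5\to v_1,\ v_2\to v_6,\ v_6\to v_8$. $H_5$: undirected edges $v_1\leftrightarrow v_3,\ v_1\leftrightarrow v_2,\ v_3\leftrightarrow v_7,\ v_5\leftrightarrow v_6,\ v_6\leftrightarrow v_8,\ v_4\leftrightarrow v_8$; arcs $v_3\to v_4,\ v_4\to v_2,\ v_2\to v_6,\ v_5\to v_1,\ v_7\to v_5,\ v_8\to v_7$. $H_6$: undirected edges $v_1\leftrightarrow v_3,\ v_1\leftrightarrow v_2,\ v_1\leftrightarrow v_5,\ v_6\leftrightarrow v_8,\ v_4\leftrightarrow v_8,\ v_7\leftrightarrow v_8$; arcs $v_3\to v_4,\ v_4\to v_2,\ v_2\to v_6,\ v_6\to v_5,\ v_5\to v_7,\ v_7\to v_3$.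
   Context: A mixed graph $G^{\phi}$ is obtained from a finite simple undirected graph $G$ (its underlying graph) by choosing a subset $S\subseteq E(G)$ and giving each edge of $S$ an orientation. Oriented edges are arcs, written $u\to v$, and the edges not in $S$ remain undirected, written $u\leftrightarrow v$. If $S=E(G)$, $G^\phi$ is an oriented graph. Degree, regularity, order, etc. refer to the underlying graph. The Hermitian-adjacency matrix $H(G^\phi)=(h_{kl})$ has $h_{kl}=h_{lk}=1$ if $k\leftrightarrow l$, $h_{kl}=i$ and $h_{lk}=-i$ if $k\to l$, and $h_{kl}=0$ otherwise, where $i$ is the imaginary unit. The Hermitian energy $\mathcal{E}_H(G^\phi)$ is the sum of the absolute values of the eigenvalues of $H(G^\phi)$ (equivalently, the sum of its singular values). A mixed graph on $n$ vertices with maximum degree $\Delta$ is an optimum Hermitian energy mixed graph if $\mathcal{E}_H(G^\phi)=n\sqrt{\Delta}$. Two mixed graphs $G^{\phi_1},G^{\phi_2}$ with the same underlying graph and the same vertex set are switching equivalent if there is a diagonal matrix $D$ with all diagonal entries in $\{1,-1\}$ such that $H(G^{\phi_2})=D^{-1}H(G^{\phi_1})D$. An isomorphism of mixed graphs is a bijection of vertex sets that preserves (in both directions) undirected edges and arcs with their directions. *)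

(* Defs.v *)
From mathcomp Require Import all_boot all_order all_algebra.

Set Implicit Arguments.
Unset Strict Implicit.
Unset Printing Implicit Defensive.

Import Order.TTheory GRing.Theory Num.Theory.
Local Open Scope ring_scope.

Record sgraph (V : finType) := SGraph {
  adj :> rel V;
  adj_sym : symmetric adj;
  adj_irr : irreflexive adj
}.

Definition degree (V : finType) (g : sgraph V) (x : V) : nat :=
  #|[set y | g x y]|.

Definition max_degree (V : finType) (g : sgraph V) : nat :=
  (\max_(x : V) degree g x)%N.

Definition regular (V : finType) (k : nat) (g : sgraph V) : Prop :=
  forall x : V, degree g x = k.

Definition sgraph_iso (V W : finType) (g : sgraph V) (h : sgraph W) : Prop :=
  exists2 f : V -> W, bijective f & forall x y, h (f x) (f y) = g x y.

Definition hypercube_adj (n : nat) : rel {ffun 'I_n -> bool} :=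
  fun x y => #|[set i | x i != y i]| == 1%N.

Lemma hypercube_sym n : symmetric (@hypercube_adj n).
Proof.
move=> x y; rewrite /hypercube_adj; congr (_ == _).
by apply: eq_card => i; rewrite !inE eq_sym.
Qed.

Lemma hypercube_irr n : irreflexive (@hypercube_adj n).
Proof.
move=> x; rewrite /hypercube_adj (_ : [set i | _] = set0) ?cards0 //.
by apply/setP => i; rewrite !inE eqxx.
Qed.

Definition hypercube (n : nat) : sgraph {ffun 'I_n -> bool} :=
  SGraph (@hypercube_sym n) (@hypercube_irr n).

(* Mixed graphs: an underlying graph some of whose edges are oriented.
   The set S of oriented edges is { {x, y} | arc x y }. *)

Record mgraph (V : finType) := MGraph {
  underlying : sgraph V;
  arc : rel V;
  arc_adj : forall x y, arc x y -> underlying x y;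
  arc_asym : forall x y, arc x y -> ~~ arc y x
}.

Definition undirected (V : finType) (G : mgraph V) : rel V :=
  fun x y => [&& underlying G x y, ~~ arc G x y & ~~ arc G y x].

Definition mgraph_iso (V W : finType) (G : mgraph V) (K : mgraph W) : Prop :=
  exists2 f : V -> W, bijective f &
    forall x y, undirected K (f x) (f y) = undirected G x y /\
                arc K (f x) (f y) = arc G x y.

(* Rows and columns are indexed through the enumeration of V. *)
Definition hermitian_adj (C : numClosedFieldType) (V : finType)
    (G : mgraph V) : 'M[C]_#|V| :=
  \matrix_(k, l)
    let x := enum_val k in let y := enum_val l in
    if undirected G x y then 1
    else if arc G x y then 'i
    else if arc G y x then - 'i
    else 0.

(* The eigenvalues with algebraic multiplicity, in some order. *)
Definition eigenvalues (C : numClosedFieldType) (n : nat)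
    (A : 'M[C]_n) : seq C :=
  sval (closed_field_poly_normal (char_poly A)).

Lemma eigenvaluesP (C : numClosedFieldType) (n : nat) (A : 'M[C]_n) :
  char_poly A = \prod_(z <- eigenvalues A) ('X - z%:P).
Proof.
rewrite /eigenvalues; case: closed_field_poly_normal => r /= {1}->.
by rewrite (monicP (char_poly_monic A)) scale1r.
Qed.

Definition hermitian_energy (C : numClosedFieldType) (V : finType)
    (G : mgraph V) : C :=
  \sum_(z <- eigenvalues (hermitian_adj C G)) `|z|.

Definition optimum_energy (C : numClosedFieldType) (V : finType)
    (G : mgraph V) : Prop :=
  hermitian_energy C G = #|V|%:R * sqrtC (max_degree (underlying G))%:R.

Definition switching_equivalent (C : numClosedFieldType) (V : finType)
    (G1 G2 : mgraph V) : Prop :=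
  underlying G1 =2 underlying G2 /\
  exists2 d : 'rV[C]_#|V|,
    forall i, d 0 i = 1 \/ d 0 i = -1 &
    hermitian_adj C G2 =
      invmx (diag_mx d) *m hermitian_adj C G1 *m diag_mx d.

Definition iso_switching (C : numClosedFieldType) (V W : finType)
    (G : mgraph V) (F : mgraph W) : Prop :=
  exists2 K : mgraph W, mgraph_iso G K & switching_equivalent C K F.

(* The seven mixed cubes. The vertex v_k is the element k - 1 of 'I_8; the
   lists below use the labels k = 1, ..., 8. *)

Definition ordered_in (s : seq (nat * nat)) (a b : nat) : bool :=
  (a, b) \in s.

Definition unordered_in (s : seq (nat * nat)) (a b : nat) : bool :=
  ((a, b) \in s) || ((b, a) \in s).

Definition cube_edges : seq (nat * nat) :=
  [:: (1, 2); (3, 4); (5, 6); (7, 8); (1, 3); (2, 4);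
      (5, 7); (6, 8); (1, 5); (2, 6); (3, 7); (4, 8)]%N.

Definition cube_adj : rel 'I_8 :=
  fun x y => unordered_in cube_edges x.+1 y.+1.

Lemma cube_sym : symmetric cube_adj.
Proof. by move=> x y; rewrite /cube_adj /unordered_in orbC. Qed.

Lemma cube_irr : irreflexive cube_adj.
Proof.
have ok : all (fun a => ~~ unordered_in cube_edges a a) (iota 1 8) by [].
by move=> x; apply/negbTE/(allP ok); rewrite mem_iota; apply: (ltn_ord x).
Qed.

Definition cube : sgraph 'I_8 := SGraph cube_sym cube_irr.

Lemma cube_hypercube : sgraph_iso cube (hypercube 3).
Proof.
have in8 (z : 'I_8) : val z \in iota 0 8 by rewrite mem_iota ltn_ord.
pose bit i (a : nat) := odd (a %/ 2 ^ i).
pose f (x : 'I_8) := [ffun i : 'I_3 => bit i x].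
have ok : all (fun a => all (fun b =>
  ((bit 0 a == bit 0 b) && (bit 1 a == bit 1 b) && (bit 2 a == bit 2 b)
    ==> (a == b)) &&
  (((bit 0 a != bit 0 b) + (bit 1 a != bit 1 b) + (bit 2 a != bit 2 b) == 1)
    == unordered_in cube_edges a.+1 b.+1)%N) (iota 0 8)) (iota 0 8).
  by [].
exists f => [|x y].
  apply: inj_card_bij => [x y /ffunP e|]; last first.
    by rewrite card_ffun card_bool !card_ord.
  have := e (inord 0); have := e (inord 1); have := e (inord 2).
  rewrite !ffunE !inordK // => e2 e1 e0; apply/val_inj/eqP.
  have /andP[+ _] := allP (allP ok _ (in8 x)) _ (in8 y).
  by rewrite e2 e1 e0 !eqxx.
have /andP[_ /eqP xy] := allP (allP ok _ (in8 x)) _ (in8 y).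
rewrite [RHS](esym xy).
rewrite /= /hypercube_adj -sum1_card big_mkcond /= !big_ord_recl big_ord0.
rewrite !inE !ffunE /= addn0 addnA.
by case: (_ != _); case: (_ != _); case: (_ != _).
Qed.

(* [us] and [ars] list the undirected edges and the arcs of a mixed graph
   with underlying graph [cube]. *)
Definition cube_lists (us ars : seq (nat * nat)) : bool :=
  all (fun a => all (fun b =>
    [&& unordered_in cube_edges a b ==
          unordered_in us a b || unordered_in ars a b,
        ~~ (unordered_in us a b && unordered_in ars a b)
      & ~~ (ordered_in ars a b && ordered_in ars b a)])
    (iota 1 8)) (iota 1 8).

Lemma cube_listsP us ars (x y : 'I_8) : cube_lists us ars ->
  [/\ cube x y = unordered_in us x.+1 y.+1 || unordered_in ars x.+1 y.+1,
      ~~ (unordered_in us x.+1 y.+1 && unordered_in ars x.+1 y.+1)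
    & ~~ (ordered_in ars x.+1 y.+1 && ordered_in ars y.+1 x.+1)].
Proof.
have in8 (z : 'I_8) : z.+1 \in iota 1 8 by rewrite mem_iota; apply: (ltn_ord z).
by move=> /allP/(_ _ (in8 x))/allP/(_ _ (in8 y))/and3P[/eqP].
Qed.

Section CubeMixed.
Variables (us ars : seq (nat * nat)) (ok : cube_lists us ars).

Definition cube_arc : rel 'I_8 := fun x y => ordered_in ars x.+1 y.+1.

Lemma cube_arc_adj x y : cube_arc x y -> cube x y.
Proof.
rewrite /cube_arc /ordered_in => xy; have [-> _ _] := cube_listsP x y ok.
by rewrite {2}/unordered_in xy orbT.
Qed.

Lemma cube_arc_asym x y : cube_arc x y -> ~~ cube_arc y x.
Proof.
by move=> xy; have [_ _] := cube_listsP x y ok; rewrite -/(cube_arc x y) xy.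
Qed.

Definition cube_mixed : mgraph 'I_8 := MGraph cube_arc_adj cube_arc_asym.

Lemma cube_mixed_undirected x y :
  undirected cube_mixed x y = unordered_in us x.+1 y.+1.
Proof.
have [Ec Du _] := cube_listsP x y ok; rewrite /undirected Ec /= -negb_or.
rewrite /cube_arc -/(unordered_in ars x.+1 y.+1); move: Du.
by case: unordered_in; case: unordered_in.
Qed.

End CubeMixed.

Definition D2 : mgraph 'I_8 := @cube_mixed
  [::]
  [:: (1, 2); (4, 3); (1, 3); (2, 4); (6, 5); (7, 8);
      (7, 5); (8, 6); (1, 5); (2, 6); (3, 7); (4, 8)]%N isT.

Definition H1 : mgraph 'I_8 := @cube_mixed
  [:: (1, 2); (1, 3); (1, 5)]%N
  [:: (3, 4); (4, 2); (2, 6); (6, 5); (5, 7); (7, 3);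
      (4, 8); (6, 8); (7, 8)]%N isT.

Definition H2 : mgraph 'I_8 := @cube_mixed
  [:: (1, 3); (2, 4); (5, 7); (6, 8)]%N
  [:: (1, 2); (2, 6); (6, 5); (1, 5); (4, 3); (8, 4); (7, 8); (7, 3)]%N isT.

Definition H3 : mgraph 'I_8 := @cube_mixed
  [:: (1, 3); (1, 2); (5, 7); (5, 6)]%N
  [:: (3, 4); (4, 2); (7, 8); (8, 6); (4, 8); (6, 2); (1, 5); (7, 3)]%N isT.

Definition H4 : mgraph 'I_8 := @cube_mixed
  [:: (1, 3); (1, 2); (3, 7); (5, 6); (7, 8)]%N
  [:: (3, 4); (4, 2); (4, 8); (7, 5); (5, 1); (2, 6); (6, 8)]%N isT.

Definition H5 : mgraph 'I_8 := @cube_mixed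
  [:: (1, 3); (1, 2); (3, 7); (5, 6); (6, 8); (4, 8)]%N
  [:: (3, 4); (4, 2); (2, 6); (5, 1); (7, 5); (8, 7)]%N isT.

Definition H6 : mgraph 'I_8 := @cube_mixed
  [:: (1, 3); (1, 2); (1, 5); (6, 8); (4, 8); (7, 8)]%N
  [:: (3, 4); (4, 2); (2, 6); (6, 5); (5, 7); (7, 3)]%N isT.

(* Main.v *)
(* Equality in Cauchy-Schwarz forces every eigenvalue of H = H(G^phi) to be
   +-sqrt 3, so that H^2 = 3 I. The off-diagonal entries of H^2 say that the two
   paths joining opposite vertices of a face of the cube have opposite weights
   in H. Encoding the entries on the edges as exponents of i in {0, 1, 3}, these
   are six congruences modulo 4 on twelve exponents; they have 504 solutions,
   and a computation sends each of them to one of the seven mixed graphs by a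
   symmetry of the cube followed by a switching. *)
Require Import Defs.
From mathcomp Require Import all_boot all_order all_algebra.
(* [path.arc] would otherwise hide [Defs.arc]. *)
Import Defs.

Set Implicit Arguments.
Unset Strict Implicit.
Unset Printing Implicit Defensive.

Import Order.TTheory GRing.Theory Num.Theory.
Local Open Scope ring_scope.

(** * Spectrum of a normal matrix and the equality case of Cauchy-Schwarz *)

Lemma char_poly_similar (R : comUnitRingType) n (P A : 'M[R]_n) :
  P \in unitmx -> char_poly (invmx P *m A *m P) = char_poly A.
Proof.
move=> Pu; rewrite /char_poly.
pose Q := map_mx polyC P; pose Q' := map_mx polyC (invmx P).
have Q'Q : Q' *m Q = 1%:M by rewrite -map_mxM mulVmx // map_mx1.
have -> : char_poly_mx (invmx P *m A *m P) = Q' *m char_poly_mx A *m Q.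
  rewrite /char_poly_mx mulmxBr mulmxBl !map_mxM; congr (_ - _).
  by rewrite scalar_mxC -mulmxA Q'Q mulmx1.
by rewrite !det_mulmx mulrAC -det_mulmx Q'Q det1 mul1r.
Qed.

(** By the spectral theorem [A] is similar to a diagonal matrix, and a product of monic linear
    factors determines its roots with multiplicity. *)
Lemma eigenvalues_spectral (C : numClosedFieldType) n (A : 'M[C]_n) :
  A \is normalmx ->
  perm_eq (eigenvalues A) [seq spectral_diag A 0 i | i <- enum 'I_n].
Proof.
move=> /orthomx_spectralP EA; apply: prod_XsubC_eq.
rewrite -eigenvaluesP {1}EA char_poly_similar ?spectral_unit //.
rewrite char_poly_trig ?diag_mx_is_trig // big_map big_enum.
by apply: eq_bigr => i _; rewrite mxE eqxx.
Qed.

(* Cauchy-Schwarz, equality case: the sum of (|z| - sqrt c)^2 over the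
   eigenvalues z vanishes. *)
Lemma hermitian_sqr_scalar (C : numClosedFieldType) n (A : 'M[C]_n) (c : C) :
  A \is hermsymmx -> 0 <= c -> \tr (A *m A) = n%:R * c ->
  \sum_(z <- eigenvalues A) `|z| = n%:R * sqrtC c -> A *m A = c%:M.
Proof.
move=> Ah c_ge0 trA; have An := hermitian_normalmx Ah.
rewrite (perm_big _ (eigenvalues_spectral An)) big_map big_enum /=.
have := orthomx_spectralP An.
move: (hermitian_spectral_diag_real Ah) (spectral_unit A).
move: (spectralmx A) (spectral_diag A) => P d /mxOverP d_real Pu EA sum_d.
have EAA : A *m A = invmx P *m diag_mx (\row_i (d 0 i ^+ 2)) *m P.
  rewrite EA !mulmxA mulmxK //.
  rewrite -(mulmxA _ (diag_mx d) (diag_mx d)) mulmx_diag.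
  by congr (_ *m diag_mx _ *m _).
have sum_d2 : \sum_i d 0 i ^+ 2 = n%:R * c.
  rewrite -trA EAA mxtrace_mulC mulmxA mulmxV // mul1mx mxtrace_diag.
  by apply: eq_bigr => i _; rewrite mxE.
have d2 i : d 0 i ^+ 2 = c.
  suff /psumr_eq0P/(_ i isT) : \sum_i (`|d 0 i| - sqrtC c) ^+ 2 = 0.
    move=> H; have /eqP : (`|d 0 i| - sqrtC c) ^+ 2 = 0.
      by apply: H => j _; rewrite -realEsqr rpredB // ger0_real ?sqrtC_ge0.
    rewrite sqrf_eq0 subr_eq0 => /eqP E.
    by rewrite -real_normK // E sqrtCK.
  (* Expanding the squares, the three sums are [n c], [2 n c] and [n c], with signs +, -, +. *)
  transitivity (\sum_i (d 0 i ^+ 2 - `|d 0 i| * (sqrtC c *+ 2) + c)).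
    by apply: eq_bigr => j _; rewrite sqrrB real_normK // sqrtCK mulrnAr.
  rewrite big_split sumrB /= -mulr_suml sum_d sum_d2 sumr_const card_ord.
  rewrite -mulrA mulrnAr -expr2 sqrtCK mulrnAr mulr2n -(mulr_natl c).
  by rewrite opprD addrA subrr add0r addNr.
rewrite EAA (_ : \row_i _ = const_mx c).
  by rewrite diag_const_mx -mulmxA -scalar_mxC mulmxA mulVmx // mul1mx.
by apply/rowP => i; rewrite !mxE d2.
Qed.

(** * Powers of ['i] and the square of the Hermitian adjacency matrix *)

Section MixedGraphs.

Variables (C : numClosedFieldType) (V : finType).
Implicit Types (G K F : mgraph V) (x y z : V).

(* On an edge of the underlying graph the entry of the Hermitian adjacency
   matrix is ['i ^+ weight G x y]; off the edges the value [0] is junk. *)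
Definition weight G x y : nat :=
  if arc G x y then 1 else if arc G y x then 3 else 0.

Lemma weightC G x y : weight G y x = ((4 - weight G x y) %% 4)%N.
Proof.
rewrite /weight; have := @arc_asym _ G x y.
by case: (arc G x y) => [/(_ isT)/negbTE-> //|_]; case: ifP.
Qed.

Lemma exprCi4 : 'i ^+ 4 = 1 :> C.
Proof. by rewrite (exprM _ 2 2) sqrCi sqrrN expr1n. Qed.

Lemma exprCi_mod n : 'i ^+ (n %% 4) = 'i ^+ n :> C.
Proof. exact/expr_mod/exprCi4. Qed.

(** This lets equalities between powers of ['i] be read as congruences modulo 4. *)
Lemma prim_rootCi : 4.-primitive_root ('i : C).
Proof.
have iNreal c : c \is Num.real -> ('i == c :> C) = false.
  by move=> c_real; apply: contraNF (nonRealCi C) => /eqP->.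
have N1 : (-1 == 1 :> C) = false.
  by rewrite eq_sym -subr_eq0 opprK -mulr2n pnatr_eq0.
have Ni1 : (- 'i == 1 :> C) = false.
  by rewrite eqr_oppLR iNreal ?rpredN ?rpred1.
apply/andP; split=> //; apply/forallP => j; rewrite unity_rootE.
case: j => [[|[|[|[|//]]]] /= _]; rewrite ?exprCi4 ?eqxx //.
- by rewrite expr1 iNreal ?rpred1.
- by rewrite sqrCi N1.
- by rewrite exprS sqrCi mulrN1 Ni1.
Qed.

Lemma exprCi_addN m n :
  'i ^+ m + 'i ^+ n = 0 :> C -> (m = n + 2 %[mod 4])%N.
Proof.
move/eqP; rewrite addr_eq0 -mulrN1 -sqrCi -exprD.
by rewrite (eq_prim_root_expr prim_rootCi) => /eqP.
Qed.

Lemma hermitian_adjE G k l :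
  hermitian_adj C G k l =
    if underlying G (enum_val k) (enum_val l)
    then 'i ^+ weight G (enum_val k) (enum_val l) else 0.
Proof.
rewrite mxE /= /undirected /weight.
have := @arc_adj _ G (enum_val k) (enum_val l).
have := @arc_adj _ G (enum_val l) (enum_val k).
rewrite (adj_sym (underlying G) (enum_val l)).
have E3 : 'i ^+ 3 = - 'i :> C by rewrite exprS sqrCi mulrN1.
by case: (underlying G _ _) (arc G _ _) (arc G _ _) => [] [] [] //=;
  rewrite ?E3 // => h1 h2; try by [have := h1 isT | have := h2 isT].
Qed.

Lemma hermitian_adj_herm G : hermitian_adj C G \is hermsymmx.
Proof.
apply/is_hermitianmxP/matrixP => k l.
rewrite expr0 scale1r [RHS]mxE [_^T _ _]mxE.
rewrite !hermitian_adjE adj_sym; case: ifP => _; last by rewrite conjC0.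
rewrite (weightC _ (enum_val l)) exprCi_mod rmorphXn /= conjCi.
set w := weight _ _ _; have le_w4 : (w <= 4)%N.
  by rewrite /w /weight; case: ifP => // _; case: ifP.
(* The goal is now ['i ^+ (4 - w) = (- 'i) ^+ w]; multiplied by ['i ^+ w], both sides become 1. *)
apply: (mulIf (expf_neq0 w (neq0Ci C))).
by rewrite -exprD subnK // exprCi4 -exprMn mulNr mulCii opprK expr1n.
Qed.

Lemma hermitian_adj_sqrE G k l :
  let x := enum_val k in let y := enum_val l in
  (hermitian_adj C G *m hermitian_adj C G) k l =
    \sum_(z | underlying G x z && underlying G z y)
      'i ^+ (weight G x z + weight G z y).
Proof.
rewrite /= mxE (reindex_onto enum_rank enum_val) => [|j _]; last first.
  by rewrite enum_valK.
rewrite [RHS]big_mkcond; apply: eq_big => [z|z _].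
  by rewrite enum_rankK eqxx.
rewrite !hermitian_adjE !enum_rankK exprD.
by do 2!case: ifP => _; rewrite ?mulr0 ?mul0r.
Qed.

(** Each closed walk x - z - x contributes ['i] to a multiple of 4, that is 1, so every diagonal
    entry of the square is a degree. *)
Lemma trace_hermitian_adj_sqr k G : regular k (underlying G) ->
  \tr (hermitian_adj C G *m hermitian_adj C G) = #|V|%:R * k%:R.
Proof.
move=> G_reg; rewrite /mxtrace.
transitivity (\sum_(i < #|V|) (k%:R : C)); last first.
  by rewrite sumr_const card_ord mulr_natl.
apply: eq_bigr => i _; rewrite hermitian_adj_sqrE /=.
rewrite -(G_reg (enum_val i)) /degree -sum1_card natr_sum.
apply: eq_big => [z|z _]; first by rewrite inE (adj_sym _ z) andbb.
rewrite (weightC _ (enum_val i)) exprD exprCi_mod -exprD.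
by rewrite /weight; do 2?case: ifP => _; rewrite ?exprCi4.
Qed.

Lemma optimum_hermitian_sqr k G :
  regular k (underlying G) -> optimum_energy C G ->
  hermitian_adj C G *m hermitian_adj C G = k%:R%:M.
Proof.
move=> G_reg G_opt; apply: hermitian_sqr_scalar;
  rewrite ?hermitian_adj_herm ?ler0n //.
  exact: trace_hermitian_adj_sqr.
have [x _|V0] := pickP (predT : pred V).
  rewrite [LHS]G_opt; congr (_ * sqrtC _%:R).
  apply/eqP; rewrite eqn_leq; apply/andP; split.
    by apply/bigmax_leqP => y _; rewrite G_reg.
  by rewrite -(G_reg x); apply: leq_bigmax.
(* Without vertices the maximum degree is 0 rather than [k], but the factor [#|V|] makes both sides
   vanish. *)
move: G_opt; rewrite /optimum_energy /hermitian_energy => ->.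
by rewrite (eq_card0 V0) !mul0r.
Qed.

(* The (x, y) entry of the square of the matrix vanishes, and only the two
   paths x - a - y and x - b - y contribute to it. *)
Lemma quadrangle_weight (c : C) G x y a b :
  hermitian_adj C G *m hermitian_adj C G = c%:M -> x != y -> a != b ->
  (forall z, underlying G x z && underlying G z y = (z == a) || (z == b)) ->
  (weight G x a + weight G a y = weight G x b + weight G b y + 2 %[mod 4])%N.
Proof.
move=> sqrH neq_xy neq_ab nbrs; apply: exprCi_addN.
have /matrixP/(_ (enum_rank x) (enum_rank y)) := sqrH.
rewrite hermitian_adj_sqrE /= !enum_rankK (eq_bigl _ _ nbrs) !mxE.
rewrite (inj_eq enum_rank_inj) (negbTE neq_xy) mulr0n => <-.
rewrite (bigD1 a) ?eqxx //= (bigD1 b) ?eqxx ?orbT 1?eq_sym //=.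
rewrite big1 ?addr0 // => z.
by case/andP=> /andP[+ /negbTE za] /negbTE zb; rewrite za zb.
Qed.

(** Since -1 is the square of ['i], conjugation by the diagonal matrix of signs [(-1) ^+ e x] adds
    [2 * (e x + e y)] to the exponent at (x, y). *)
Lemma weight_switching K F (e : V -> bool) :
  underlying K =2 underlying F ->
  (forall x y, underlying F x y ->
     weight F x y = weight K x y + 2 * (e x + e y) %[mod 4])%N ->
  switching_equivalent C K F.
Proof.
move=> eqKF we; split=> //.
pose d : 'rV[C]_#|V| := \row_i (-1) ^+ e (enum_val i).
have dd : diag_mx d *m diag_mx d = 1%:M.
  rewrite mulmx_diag -diag_const_mx; congr diag_mx; apply/rowP => i.
  by rewrite !mxE -expr2 sqrr_sign.
have inv_d : invmx (diag_mx d) = diag_mx d.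
  have [du _] := mulmx1_unit dd.
  by rewrite -[LHS]mulmx1 -dd mulKmx.
exists d => [i|].
  by rewrite mxE; case: (e _); [right | left].
apply/matrixP => i j; rewrite inv_d mul_diag_mx mul_mx_diag [RHS]mxE.
rewrite [X in X * _]mxE !hermitian_adjE eqKF.
case: ifP => [Fij|_]; last by rewrite mulr0 mul0r.
rewrite !mxE -exprCi_mod we // exprCi_mod exprD exprM sqrCi exprD.
by rewrite mulrCA mulrA.
Qed.

End MixedGraphs.

Section Relabelling.

Variables (V W : finType) (f : W -> V) (G : mgraph V).

Definition relabel_sgraph (g : sgraph V) : sgraph W :=
  SGraph (fun x y => adj_sym g (f x) (f y)) (fun x => adj_irr g (f x)).

Definition relabel : mgraph W :=
  @MGraph W (relabel_sgraph (underlying G)) (fun x y => arc G (f x) (f y))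
    (fun x y => @arc_adj _ G (f x) (f y))
    (fun x y => @arc_asym _ G (f x) (f y)).

Lemma mgraph_iso_relabel : bijective f -> mgraph_iso G relabel.
Proof.
by case=> g fK gK; exists g => [|x y]; [exists f | rewrite /undirected /= !gK].
Qed.

End Relabelling.

(** * Exponent lists on the cube and the pruned search *)

Definition edge_weights (K : mgraph 'I_8) : seq nat :=
  [seq weight K (inZp d.1.-1) (inZp d.2.-1) | d <- cube_edges].

Definition edge_index (a b : nat) : nat :=
  index (if a < b then (a, b) else (b, a))%N cube_edges.

(* The exponent of ['i] in the entry at the edge v_a v_b, when [s] lists the
   exponents along [cube_edges]. *)
Definition entry (s : seq nat) (a b : nat) : nat :=
  let w := nth 0%N s (edge_index a b) in
  if (a < b)%N then w else ((4 - w) %% 4)%N.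

Lemma entry_cat s t a b :
  (edge_index a b < size s)%N -> entry (s ++ t) a b = entry s a b.
Proof. by move=> lt_s; rewrite /entry nth_cat lt_s. Qed.

Lemma entry_edge_weights (K : mgraph 'I_8) (x y : 'I_8) :
  cube x y -> entry (edge_weights K) x.+1 y.+1 = weight K x y.
Proof.
(* Each edge is listed with its smaller label first; the reversed direction follows from
   [weightC]. *)
have in_edges (u v : 'I_8) : (u < v)%N -> cube u v ->
    nth 0%N (edge_weights K) (index (u.+1, v.+1) cube_edges) = weight K u v.
  move=> lt_uv /orP uv; have {}uv : (u.+1, v.+1) \in cube_edges.
    case: uv => // vu.
    have /allP/(_ _ vu) : all (fun d => d.1 < d.2)%N cube_edges by [].
    by rewrite /= ltnS ltnNge ltnW.
  by rewrite (nth_map (0, 0)%N) ?index_mem // nth_index //= !valZpK.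
move=> xy; rewrite /entry /edge_index ltnS; case: ltnP => [lt_xy|le_yx].
  exact: in_edges.
have lt_yx : (y < x)%N.
  rewrite ltn_neqAle le_yx andbT.
  by apply: contraTneq xy => /val_inj->; rewrite adj_irr.
by rewrite in_edges -?weightC // adj_sym.
Qed.

(* [(a, b, c, d)] stands for the face with consecutive vertices
   v_a, v_b, v_c, v_d. *)
Definition cube_faces : seq (nat * nat * nat * nat) :=
  [:: (1, 2, 4, 3); (5, 6, 8, 7); (1, 2, 6, 5); (3, 4, 8, 7); (1, 3, 7, 5);
      (2, 4, 8, 6)]%N.

(** One diagonal per face is enough: reversing an edge negates its exponent modulo 4, so the
    diagonal from b to d yields the same congruence. *)
Definition face_ok (s : seq nat) (f : nat * nat * nat * nat) : bool :=
  let: (a, b, c, d) := f in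
  (entry s a b + entry s b c == entry s a d + entry s d c + 2 %[mod 4])%N.

Definition face_known (n : nat) (f : nat * nat * nat * nat) : bool :=
  let: (a, b, c, d) := f in
  [&& edge_index a b < n, edge_index b c < n, edge_index a d < n
    & edge_index d c < n]%N.

Definition face_violated (s : seq nat) : bool :=
  has (fun f => face_known (size s) f && ~~ face_ok s f) cube_faces.

(** A face whose four edges lie in the prefix [s] keeps its exponents in every extension, so pruning
    loses no solution. *)
Lemma face_violated_cat s t :
  all (face_ok (s ++ t)) cube_faces -> face_violated s = false.
Proof.
move/allP=> t_ok; apply/hasP => -[f /t_ok].
case: f => [[[a b] c] d] /= + /andP[/and4P[ab bc ad dc]].
by rewrite !entry_cat // => ->.
Qed.

(* Conditionals rather than [||]: [vm_compute] evaluates both arguments of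
   [orb], which would defeat the pruning. *)
Fixpoint search (goal : pred (seq nat)) (n : nat) (s : seq nat) : bool :=
  if face_violated s then true else
  if n is m.+1 then all (fun w => search goal m (rcons s w)) [:: 0; 1; 3]%N
  else goal s.

Lemma searchP goal n s t : search goal n s -> size t = n ->
  {subset t <= [:: 0; 1; 3]%N} -> all (face_ok (s ++ t)) cube_faces ->
  goal (s ++ t).
Proof.
elim: n s t => [|n IHn] s t search_s sz_t t013 t_ok.
  by move: search_s; rewrite /= (face_violated_cat t_ok) (size0nil sz_t) cats0.
have /allP search_rcons :
    all (fun w => search goal n (rcons s w)) [:: 0; 1; 3]%N.
  by move: search_s; rewrite /= (face_violated_cat t_ok).
case: t sz_t t013 t_ok => // w t [sz_t] t013; rewrite -cat_rcons => t_ok.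
apply: IHn => // [|x x_t]; first by apply/search_rcons/t013/mem_head.
by apply: t013; rewrite inE x_t orbT.
Qed.

(** * Symmetries of the cube and the test for switching equivalence *)

Definition comp_labels (p q : seq nat) : seq nat :=
  [seq nth 0%N p a.-1 | a <- q].

(* A symmetry of the cube is the list of the images of v_1, ..., v_8; these
   are the 8 translations of the group Z_2^3 composed with the 6 permutations
   of its coordinates. *)
Definition cube_symmetries : seq (seq nat) :=
  [seq comp_labels p q | p <-
     [:: [:: 1; 2; 3; 4; 5; 6; 7; 8]; [:: 2; 1; 4; 3; 6; 5; 8; 7];
         [:: 3; 4; 1; 2; 7; 8; 5; 6]; [:: 4; 3; 2; 1; 8; 7; 6; 5];
         [:: 5; 6; 7; 8; 1; 2; 3; 4]; [:: 6; 5; 8; 7; 2; 1; 4; 3];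
         [:: 7; 8; 5; 6; 3; 4; 1; 2]; [:: 8; 7; 6; 5; 4; 3; 2; 1]],
   q <-
     [:: [:: 1; 2; 3; 4; 5; 6; 7; 8]; [:: 1; 3; 2; 4; 5; 7; 6; 8];
         [:: 1; 2; 5; 6; 3; 4; 7; 8]; [:: 1; 5; 3; 7; 2; 6; 4; 8];
         [:: 1; 3; 5; 7; 2; 4; 6; 8]; [:: 1; 5; 2; 6; 3; 7; 4; 8]]]%N.

Definition symmetry_map (p : seq nat) (x : 'I_8) : 'I_8 :=
  inZp (nth 0%N p x).-1.

Lemma cube_symmetryP p : p \in cube_symmetries ->
  [/\ bijective (symmetry_map p),
      forall x y, cube (symmetry_map p x) (symmetry_map p y) = cube x y
    & forall x : 'I_8, nth 0%N p x = (symmetry_map p x).+1].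
Proof.
(* [im] mirrors [symmetry_map] on the numbers 0 to 7, where the properties can be checked by
   evaluation. *)
pose im p a := ((nth 0 p a).-1 %% 8)%N.
have ok : all (fun p => all (fun a => all (fun b =>
    [&& (im p a == im p b) ==> (a == b),
    unordered_in cube_edges (im p a).+1 (im p b).+1
       == unordered_in cube_edges a.+1 b.+1 & nth 0 p a == (im p a).+1])
    (iota 0 8)) (iota 0 8)) cube_symmetries.
  by vm_compute.
have in8 (z : 'I_8) : val z \in iota 0 8 by rewrite mem_iota ltn_ord.
move=> /(allP ok) {}ok.
have ok2 x y := allP (allP ok _ (in8 x)) _ (in8 y).
split=> [|x y|x]; [|by have /and3P[_ /eqP] := ok2 x y|]; last first.
  by have /and3P[_ _ /eqP] := ok2 x x.
apply: injF_bij => x y /(congr1 val) exy; apply/val_inj/eqP.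
by have /and3P[/implyP-> //] := ok2 x y; apply/eqP.
Qed.

Definition cube_darts : seq (nat * nat) :=
  cube_edges ++ [seq (d.2, d.1) | d <- cube_edges].

Lemma cube_dart (x y : 'I_8) : cube x y -> (x.+1, y.+1) \in cube_darts.
Proof.
rewrite mem_cat => /orP[->//|yx]; apply/orP; right.
by apply/mapP; exists (y.+1, x.+1).
Qed.

(* The switching signs are forced, up to a global sign, along the spanning
   tree v_1v_2, v_1v_3, v_1v_5, v_2v_4, v_2v_6, v_3v_7, v_4v_8. *)
Definition tree_signs (x : nat -> nat -> bool) : seq bool :=
  let x2 := x 1 2 in let x3 := x 1 3 in let x5 := x 1 5 in
  let x4 := x2 (+) x 2 4 in
  [:: false; x2; x3; x4; x5; x2 (+) x 2 6; x3 (+) x 3 7; x4 (+) x 4 8]%N.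

Definition symmetry_switches (s t : seq nat) (p : seq nat) : bool :=
  let w a b := entry s (nth 0 p a.-1)%N (nth 0 p b.-1)%N in
  let e := tree_signs (fun a b => entry t a b != w a b) in
  all (fun d => entry t d.1 d.2 == w d.1 d.2 +
         2 * (nth false e d.1.-1 + nth false e d.2.-1) %[mod 4])%N cube_darts.

(* Symmetries and switchings preserve the number of undirected edges. *)
Definition similar_weights (s t : seq nat) : bool :=
  if count_mem 0%N s == count_mem 0%N t
  then has (symmetry_switches s t) cube_symmetries else false.

Lemma iso_switching_trans (C : numClosedFieldType) (U V W : finType)
    (G : mgraph U) (K : mgraph V) (F : mgraph W) :
  mgraph_iso G K -> iso_switching C K F -> iso_switching C G F.
Proof.
case=> f f_bij fG [L [g g_bij gK] LF]; exists L => //.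
exists (g \o f) => [|x y]; first exact: bij_comp.
by have [<- <-] := fG x y; apply: gK.
Qed.

Lemma similar_iso_switching (C : numClosedFieldType) (K F : mgraph 'I_8) :
  underlying K =2 cube -> underlying F =2 cube ->
  similar_weights (edge_weights K) (edge_weights F) -> iso_switching C K F.
Proof.
move=> K_cube F_cube; rewrite /similar_weights; case: ifP => // _.
move=> /hasP[p p_sym /allP sw].
have [p_bij p_cube p_label] := cube_symmetryP p_sym.
exists (relabel (symmetry_map p) K); first exact: mgraph_iso_relabel.
pose e := tree_signs (fun a b => entry (edge_weights F) a b !=
  entry (edge_weights K) (nth 0 p a.-1)%N (nth 0 p b.-1)%N).
apply: (@weight_switching C _ _ _ (fun x : 'I_8 => nth false e x)) => x y.
  by rewrite /= K_cube F_cube p_cube.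
rewrite F_cube => xy; have /eqP := sw _ (cube_dart xy).
rewrite entry_edge_weights //= => ->.
by rewrite !p_label entry_edge_weights ?p_cube.
Qed.

(** * The finite computation and its application to mixed graphs on the cube *)

Definition classified (s : seq nat) : bool :=
  let sim F := similar_weights s (edge_weights F) in
  [|| sim D2, sim H1, sim H2, sim H3, sim H4, sim H5 | sim H6].

Lemma search_classified : search classified 12 [::].
Proof. by vm_compute. Qed.

Lemma sgraph_iso_sym (V W : finType) (g : sgraph V) (h : sgraph W) :
  sgraph_iso g h -> sgraph_iso h g.
Proof.
case=> f [f' fK f'K] gh; exists f' => [|x y]; first by exists f.
by rewrite -gh !f'K.
Qed.

Lemma sgraph_iso_trans (U V W : finType) (g : sgraph U) (h : sgraph V)
    (k : sgraph W) :
  sgraph_iso g h -> sgraph_iso h k -> sgraph_iso g k.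
Proof.
case=> f f_bij gh [f' f'_bij hk]; exists (f' \o f) => [|x y].
  exact: bij_comp.
by rewrite hk gh.
Qed.

(** Opposite vertices of a face have exactly the other two vertices of that face as common
    neighbours, so [quadrangle_weight] applies. *)
Lemma face_ok_edge_weights (C : numClosedFieldType) (c : C) (V : finType)
    (G : mgraph V) (v : 'I_8 -> V) :
  bijective v -> underlying (relabel v G) =2 cube ->
  hermitian_adj C G *m hermitian_adj C G = c%:M ->
  all (face_ok (edge_weights (relabel v G))) cube_faces.
Proof.
move=> [v' vK v'K] v_cube sqrH; apply/allP.
have ok : all (fun f => let: (x, y, z, t) := f in
    [&& all (fun k => 0 < k < 9)%N [:: x; y; z; t], x != z, y != t &
      all (fun k => unordered_in cube_edges x k.+1 &&
        unordered_in cube_edges k.+1 z == (k.+1 == y) || (k.+1 == t))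
      (iota 0 8)]) cube_faces by [].
have label k : (0 < k < 9)%N -> exists x : 'I_8, k = x.+1.
  by case: k => // k lt_k8; exists (Ordinal (lt_k8 : (k < 8)%N)).
move=> [[[x y] z] t] /(allP ok) {ok} /and4P[/and5P[/label[{}x ->]]].
move=> /label[{}y ->] /label[{}z ->] /label[{}t ->] _.
rewrite !eqSS !(inj_eq val_inj) => neq_xz neq_yt /allP nbrs.
have {}nbrs u : cube x u && cube u z = (u == y) || (u == t).
  by apply/eqP; apply: (nbrs u); rewrite mem_iota ltn_ord.
have := nbrs y; have := nbrs t; rewrite !eqxx orbT /=.
case/andP=> xt tz /andP[xy yz]; rewrite !entry_edge_weights //.
apply/eqP/(quadrangle_weight sqrH); rewrite ?(can_eq vK) // => u.
by rewrite -[u]v'K !(can_eq vK) -nbrs -!v_cube.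
Qed.

Theorem theorem3p2 (C : numClosedFieldType) (V : finType) (G : mgraph V)
    (hreg : regular 3 (underlying G))
    (hopt : optimum_energy C G)
    (hQ3 : sgraph_iso (underlying G) (hypercube 3)) :
  iso_switching C G D2 \/ iso_switching C G H1 \/ iso_switching C G H2 \/
  iso_switching C G H3 \/ iso_switching C G H4 \/ iso_switching C G H5 \/
  iso_switching C G H6.
Proof.
have [v v_bij v_cube] :=
  sgraph_iso_trans cube_hypercube (sgraph_iso_sym hQ3).
pose s := edge_weights (relabel v G).
have s013 : {subset s <= [:: 0; 1; 3]%N}.
  by move=> w /mapP[d _ ->]; rewrite /weight; do 2?case: ifP.
have s_ok : all (face_ok s) cube_faces.
  exact: face_ok_edge_weights v_bij v_cube (optimum_hermitian_sqr hreg hopt).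
have GK := mgraph_iso_relabel G v_bij.
have sim F : underlying F =2 cube ->
    similar_weights s (edge_weights F) -> iso_switching C G F.
  by move=> F_cube /similar_iso_switching-/(_ C v_cube F_cube);
    apply: iso_switching_trans.
have : classified ([::] ++ s) by apply: searchP search_classified _ s013 s_ok.
(* Each of the seven graphs has [cube] as underlying graph by definition, hence the [erefl]. *)
case/or4P=> [|||/or4P[]] /sim-/(_ (fun _ _ => erefl)); tauto.
Qed.
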